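(* For every integer $n\ge 1$, there is no subset $A$ of the cube $C_n=\{0,1,-1\}^n\subseteq\mathbb{R}^n$ satisfying all three of the following conditions: (a) $e_k\in A$ for $1\le k\le n$; (b) $A$ is symmetric, that is, if $x\in A$ then $-x\in A$; (c) for every subset $B$ of $A$ with $|B|=n+1$ there exist distinct $x,y\in B$ such that $x-y\in A$.
   Context: $e_1,\dots,e_n$ denotes the standard basis of $\mathbb{R}^n$. Differences $x-y$ are taken in $\mathbb{R}^n$ (so $x-y$ need not lie in $C_n$). *)

(* Defs.v *)
From mathcomp Require Import all_boot all_order all_algebra.
From mathcomp Require Import boolp classical_sets functions cardinality reals.

Set Implicit Arguments.
Unset Strict Implicit.
Unset Printing Implicit Defensive.

Import Order.TTheory GRing.Theory Num.Theory.
Local Open Scope classical_set_scope.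
Local Open Scope ring_scope.

Definition cube (R : realType) (n : nat) : set 'rV[R]_n :=
  [set x | forall i : 'I_n, x 0 i \in [:: 0; 1; -1]].
Arguments cube : clear implicits.

(* Main.v *)
(** Fix a linear form f that vanishes on no nonzero point of the cube.  As for
    simple roots of a root system, call x in A simple if f(x) > 0 and x is not
    the sum of two elements of A on which f is positive.  The simple elements
    span, so there are at least n of them, and no difference of two distinct
    ones lies in A: if x - y is in A, then x = y + (x - y) or y = x + (y - x)
    contradicts simplicity.  If y maximizes f on A, then y + x is not in A for
    any x with f(x) > 0, so -y can be added to n simple elements. *)
Require Import Defs.
From mathcomp Require Import all_boot all_order all_algebra.
From mathcomp Require Import boolp classical_sets functions cardinality reals.
From mathcomp Require Import finmap lra.

Set Implicit Arguments.
Unset Strict Implicit.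
Unset Printing Implicit Defensive.

Import Order.TTheory GRing.Theory Num.Theory.
Local Open Scope classical_set_scope.
Local Open Scope ring_scope.

(** The absolute value of the sum is at most [1 + 3 + ... + 3^(m-1) = (3^m - 1)/2]. *)
Lemma normr_sum_ternary (R : realFieldType) (g : nat -> R) (m : nat) :
  (forall i, `|g i| <= 1) -> 2 * `|\sum_(i < m) 3 ^+ i * g i| < 3 ^+ m.
Proof.
move=> g1; elim: m => [|m IH]; first by rewrite big_ord0 normr0 mulr0.
rewrite big_ord_recr /= exprS.
have t0 : 0 < 3 ^+ m :> R by rewrite exprn_gt0.
have := ler_normD (\sum_(i < m) 3 ^+ i * g i) (3 ^+ m * g m).
have : `|3 ^+ m * g m| <= 3 ^+ m.
  by rewrite normrM (gtr0_norm t0) ler_piMr // ltW.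
by move: IH; lra.
Qed.

(** Uniqueness of balanced ternary expansions, for the number zero: the lower digits contribute less
    than half of [3 ^+ m], so they cannot cancel a top digit [1] or [-1]. The top digit is then
    zero, and induction handles the others. *)
Lemma sum_ternary_eq0 (R : realFieldType) (g : nat -> R) (m : nat) :
  (forall i, g i \in [:: 0; 1; -1]) -> \sum_(i < m) 3 ^+ i * g i = 0 ->
  forall i, (i < m)%N -> g i = 0.
Proof.
move=> g3; elim: m => // m IH; rewrite big_ord_recr /= => s0.
have g1 i : `|g i| <= 1.
  by move: (g3 i); rewrite !inE => /or3P[]/eqP->; rewrite ?normrN ?normr0 ?normr1.
have gm : g m = 0.
  have lt_m := normr_sum_ternary m g1.
  have t0 : 0 < 3 ^+ m :> R by rewrite exprn_gt0.
  move: lt_m; rewrite -normrN (addr0_eq s0) normrM (gtr0_norm t0).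
  move: (g3 m); rewrite !inE => /or3P[]/eqP-> //; rewrite ?normrN normr1; lra.
move: s0; rewrite gm mulr0 addr0 => /IH g0 i.
by rewrite ltnS leq_eqVlt => /orP[/eqP->|/g0].
Qed.

Lemma seq_argmax (R : realFieldType) (T : eqType) (f : T -> R) (s : seq T) :
  s != [::] -> exists2 y, y \in s & {in s, forall z, f z <= f y}.
Proof.
elim: s => // x s IH _; case: (eqVneq s [::]) => [->|/IH[y ys ymax]].
  by exists x; rewrite ?mem_head // => z; rewrite inE => /eqP->.
have [xy|/ltW yx] := leP (f x) (f y).
  exists y; first by rewrite inE ys orbT.
  by move=> z; rewrite inE => /orP[/eqP->|/ymax].
exists x; first exact: mem_head.
by move=> z; rewrite inE => /orP[/eqP->//|/ymax/le_trans]; apply.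
Qed.

Section SimpleElements.
Variables (R : realFieldType) (V : vectType R) (s : seq V) (f : V -> R).
Hypotheses (fB : {morph f : x y / x - y})
  (f_neq0 : {in s, forall x, x != 0 -> f x != 0})
  (sN : {in s, forall x, - x \in s}).

Let f0 : f 0 = 0. Proof. by rewrite -(subrr 0) fB subrr. Qed.
Let fN x : f (- x) = - f x. Proof. by rewrite -sub0r fB f0 sub0r. Qed.

(** A decomposition of [x] is searched through one summand [y], the other being [x - y]. The [undup]
    makes [size] count distinct elements. *)
Definition simple_elements : seq V :=
  undup [seq x <- s | (0 < f x) &&
    ~~ has (fun y => [&& 0 < f y, 0 < f (x - y) & x - y \in s]) s].

Lemma mem_simple x : x \in simple_elements ->
  [/\ x \in s, 0 < f x &
      forall y, y \in s -> 0 < f y -> 0 < f (x - y) -> x - y \notin s].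
Proof.
rewrite mem_undup mem_filter => /andP[/andP[fx /hasPn hx] xs]; split=> // y ys fy fxy.
by have := hx y ys; rewrite fy fxy.
Qed.

Lemma simple_sub_notin :
  {in simple_elements &, forall x y, x != y -> x - y \notin s}.
Proof.
move=> x y /mem_simple[xs fx hx] /mem_simple[ys fy hy] xy; apply/negP => xys.
have : f (x - y) != 0 by rewrite f_neq0 // subr_eq0.
rewrite neq_lt => /orP[lt0|gt0]; last by have := hx y ys fy gt0; rewrite xys.
have yxs : y - x \in s by rewrite -opprB sN.
have gt0 : 0 < f (y - x) by rewrite -opprB fN oppr_gt0.
by have := hy x xs fx gt0; rewrite yxs.
Qed.

(** Minimal counterexample: among the positive elements outside the span, take [w] with [f w] least,
    found by maximizing [- f]. It is not simple, so it splits as [y + (w - y)]; both summands have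
    smaller positive values, hence lie in the span, and so does [w]. *)
Lemma pos_in_span_simple x :
  x \in s -> 0 < f x -> x \in <<simple_elements>>%VS.
Proof.
move=> xs fx; apply/negPn/negP => xd.
pose bad := [seq z <- s | (0 < f z) && (z \notin <<simple_elements>>%VS)].
have badE z : z \in bad = [&& 0 < f z, z \notin <<simple_elements>>%VS & z \in s].
  by rewrite mem_filter andbA.
have : bad != [::].
  by apply/eqP => bad0; have := badE x; rewrite bad0 fx xd xs.
move=> /(seq_argmax (fun z => - f z))[w]; rewrite badE => /and3P[fw wd ws] wmin.
have small z : z \in s -> 0 < f z -> f z < f w -> z \in <<simple_elements>>%VS.
  move=> zs fz zw; apply/negPn/negP => zd.
  have /wmin : z \in bad by rewrite badE fz zd zs.
  by rewrite lerN2 leNgt zw.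
have : w \notin simple_elements by apply: contra wd => /memv_span.
rewrite mem_undup mem_filter fw ws andbT /= negbK.
move=> /hasP[y ys /and3P[fy fwy wys]].
have yd : y \in <<simple_elements>>%VS by apply: small => //; rewrite -subr_gt0 -fB.
have wyd : w - y \in <<simple_elements>>%VS.
  by apply: small => //; rewrite fB gtrDl oppr_lt0.
by move: wd; rewrite -(subrK y w) memvD.
Qed.

Lemma span_simple : (<<s>> <= <<simple_elements>>)%VS.
Proof.
apply/span_subvP => x xs; have [->|/(f_neq0 xs)] := eqVneq x 0; first exact: mem0v.
rewrite neq_lt => /orP[fx|]; last exact: pos_in_span_simple.
by rewrite -memvN pos_in_span_simple ?sN // fN oppr_gt0.
Qed.

Lemma difference_free_seq : (0 < \dim <<s>>)%N ->
  exists B : seq V, [/\ size B = (\dim <<s>>).+1, uniq B, {subset B <= s} &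
    {in B &, forall x y, x != y -> x - y \notin s}].
Proof.
move=> dim_gt0; set d := simple_elements.
have le_d : (\dim <<s>> <= size d)%N.
  exact: leq_trans (dimvS span_simple) (dim_span _).
(* A simple element is needed to know that the maximum of [f] on [s] is positive, which keeps [- y]
   out of [d]. *)
have [a ad] : exists a, a \in d.
  by case: d le_d => [|a d' _]; [rewrite leqNgt dim_gt0|exists a; exact: mem_head].
have [as_ fa _] := mem_simple ad.
have [|y ys ymax] := @seq_argmax _ _ f s; first by case: (s) as_.
have fy : 0 < f y := lt_le_trans fa (ymax a as_).
have yd x : x \in d -> x + y \notin s.
  move=> /mem_simple[_ fx _]; apply/negP => /ymax.
  by rewrite -[X in x + X]opprK fB fN opprK gerDr leNgt fx.
(* There may be more simple elements than the dimension; the exact size requires truncation. *)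
pose d' := take (\dim <<s>>) d.
have d'd x : x \in d' -> x \in d by apply: mem_take.
exists (- y :: d'); split.
- by rewrite /= size_takel.
- rewrite /= take_uniq ?undup_uniq // andbT; apply/negP => /d'd/mem_simple[_].
  by rewrite fN oppr_gt0 ltNge (ltW fy).
- by move=> x; rewrite inE => /orP[/eqP->|/d'd/mem_simple[]//]; exact: sN.
- move=> u v; rewrite !inE => /orP[/eqP->|/d'd ud] /orP[/eqP->|/d'd vd].
  + by rewrite eqxx.
  (* By symmetry, [- y - v] in [s] would put [v + y] in [s]. *)
  + move=> _; apply: contra (yd v vd) => /sN.
    by rewrite opprB opprK.
  + by move=> _; rewrite opprK yd.
  + exact: simple_sub_notin.
Qed.

End SimpleElements.

Lemma finite_cube (R : realType) (n : nat) : finite_set (cube R n).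
Proof.
pose h (g : {ffun 'I_n -> 'I_3}) : 'rV[R]_n := \row_i [:: 0; 1; -1]`_(g i).
apply: (@sub_finite_set _ _ (h @` setT)); last exact: finite_image.
move=> x cx; exists [ffun i => inord (index (x 0 i) [:: 0; 1; -1])] => //.
apply/rowP => i; rewrite mxE ffunE inordK ?nth_index ?cx //.
by have := cx i; rewrite -index_mem.
Qed.

Theorem theorem1 (R : realType) (n : nat) (hn : (1 <= n)%N) :
  ~ exists A : set 'rV[R]_n,
      [/\ A `<=` cube R n,
          forall k : 'I_n, A (delta_mx 0 k),
          forall x : 'rV[R]_n, A x -> A (- x)
        & forall B : set 'rV[R]_n, B `<=` A -> (B #= `I_n.+1)%card ->
            exists x y : 'rV[R]_n, [/\ B x, B y, x <> y & A (x - y)]].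
Proof.
case=> A [Acube Adelta AN AB].
have /finite_seqP[s As] : finite_set A.
  exact: sub_finite_set Acube (finite_cube R n).
subst A.
(* Points of the cube are read as balanced ternary expansions, so only the zero vector has value
   zero. *)
pose f (x : 'rV[R]_n) := \sum_(i < n) 3 ^+ i * x 0 i.
have fB : {morph f : x y / x - y}.
  move=> x y; rewrite /f; under eq_bigr do rewrite !mxE mulrBr.
  by rewrite sumrB.
have f_neq0 : {in s, forall x, x != 0 -> f x != 0}.
  move=> x /Acube cx; apply: contra => /eqP fx.
  (* The coordinates are extended by zero to all naturals; zero is still an admissible digit. *)
  pose g (i : nat) := if insub i is Some j then x 0 (j : 'I_n) else 0.
  have gE (i : 'I_n) : g i = x 0 i by rewrite /g valK.
  have g3 i : g i \in [:: 0; 1; -1].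
    by rewrite /g; case: insubP => [j _ _|_]; [exact: cx|exact: mem_head].
  have : \sum_(i < n) 3 ^+ i * g i = 0.
    by rewrite -[RHS]fx; apply: eq_bigr => i _; rewrite gE.
  move=> /(sum_ternary_eq0 g3) g0; apply/eqP/rowP => i.
  by rewrite -gE g0 // mxE.
(* The standard basis lies in [s], so the span is the whole space. *)
have dim_s : \dim <<s>> = n.
  suff -> : <<s>>%VS = fullv by rewrite dimvf dim_matrix mul1r.
  apply/eqP; rewrite eqEsubv subvf; apply/subvP => x _.
  rewrite [x]row_sum_delta; apply: memv_suml => i _.
  by apply/memvZ/memv_span/Adelta.
have [|B [sizeB uB Bs BN]] := difference_free_seq fB f_neq0 AN; first by rewrite dim_s.
have [] := AB [set` B].
- exact: Bs.
- have -> : [set` B] = [set` [fset x in B]%fset].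
    by apply/seteqP; split=> x /=; rewrite inE.
  by apply/card_eq_fsetP; rewrite card_fseq undup_id // sizeB dim_s.
- move=> x [y [xB yB /eqP xy]] /=.
  by rewrite (negbTE (BN x y xB yB xy)).
Qed.
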